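(* Let $G$ be a torsion-free abelian group which decomposes as $G = A \oplus H$ where $A$ is completely decomposable and $H$ is clipped. Then $A$ is unique up to isomorphism; that is, if also $G = A' \oplus H'$ with $A'$ completely decomposable and $H'$ clipped, then $A \cong A'$.
   Context: Groups are torsion-free abelian groups of arbitrary (possibly infinite) rank. A group is completely decomposable if it is a direct sum (possibly infinite, possibly empty) of groups of rank $1$. A torsion-free abelian group $H$ is clipped if it has no direct summand of rank $1$. *)

(* Defs.v *)
From mathcomp Require Import all_boot all_order all_algebra.
From mathcomp Require Import boolp classical_sets functions cardinality.
From mathcomp Require Import fsbigop.

Set Implicit Arguments.
Unset Strict Implicit.
Unset Printing Implicit Defensive.

Import GRing.Theory.
Local Open Scope classical_set_scope.
Local Open Scope ring_scope.

Definition torsion_free (G : zmodType) : Prop :=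
  forall (x : G) (n : nat), (0 < n)%N -> x *+ n = 0 -> x = 0.

Definition subgroup (G : zmodType) (A : set G) : Prop :=
  A 0 /\ forall x y : G, A x -> A y -> A (x - y).

Definition isomorphic (G G' : zmodType) (A : set G) (A' : set G') : Prop :=
  exists f : G -> G',
    (forall x y : G, A x -> A y -> f (x + y) = f x + f y) /\ set_bij A A' f.

Definition zindependent (G : zmodType) (n : nat) (v : 'I_n -> G) : Prop :=
  forall c : 'I_n -> int, \sum_(i < n) v i *~ c i = 0 -> forall i, c i = 0.

(* [A] has finite rank [n]: [n] is the largest size of a linearly independent
   family of elements of [A]. *)
Definition has_rank (G : zmodType) (A : set G) (n : nat) : Prop :=
  (exists v : 'I_n -> G, (forall i, A (v i)) /\ zindependent v) /\
  (forall (m : nat) (v : 'I_m -> G),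
     (forall i, A (v i)) -> zindependent v -> (m <= n)%N).

(* Internal direct sum of two subgroups: the addition map from the external
   direct sum onto [C] is a bijection. *)
Definition direct_sum2 (G : zmodType) (C A B : set G) : Prop :=
  [/\ subgroup A, subgroup B &
      set_bij (A `*` B) C (fun p : G * G => p.1 + p.2)].

(* Internal direct sum of an arbitrary family of subgroups: the external direct
   sum is the set of finitely supported [f] with [f i] in [B i] for all [i]. *)
Definition direct_sum (G : zmodType) (I : choiceType) (C : set G)
    (B : I -> set G) : Prop :=
  (forall i, subgroup (B i)) /\
  set_bij
    [set f : I -> G | (forall i, B i (f i)) /\ finite_set [set i | f i != 0]]
    C (fun f => \sum_(i \in [set: I]) f i).

Definition completely_decomposable (G : zmodType) (A : set G) : Prop :=
  exists (I : choiceType) (B : I -> set G),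
    (forall i, has_rank (B i) 1) /\ direct_sum A B.

Definition clipped (G : zmodType) (H : set G) : Prop :=
  ~ exists K L : set G, direct_sum2 H K L /\ has_rank K 1.

(* Main.v *)
Require Import Defs.
From HB Require Import structures.
From mathcomp Require Import all_boot all_order all_algebra.
From mathcomp Require Import boolp classical_sets functions.
From mathcomp Require Import cardinality fsbigop wochoice.

Set Implicit Arguments.
Unset Strict Implicit.
Unset Printing Implicit Defensive.

Import GRing.Theory Num.Theory.
Local Open Scope classical_set_scope.
Local Open Scope ring_scope.

(* Write [A] and [A'] as sums of rank 1 groups [B i] and [B' j].  If [y] is a
   nonzero element of a sum of copies of [B i], the pure subgroup it generates
   is a retract of [G] isomorphic to [B i].  Rank 1 groups with nonzero maps in
   both directions are isomorphic, so if [y] had no component in a [B' j]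
   isomorphic to [B i], this retraction would factor through [H'], which is
   clipped.  Hence each homogeneous part of [A] embeds into that of [A'], and
   Gaussian elimination along well-orders of the index sets, which works in
   any rank, turns this into an injection of indices preserving isomorphism
   types.  Conclude by symmetry and Schroeder-Bernstein. *)

(** * Subgroups, integer multiples and additive maps *)

Lemma subgroupN (G : zmodType) (A : set G) x : subgroup A -> A x -> A (- x).
Proof. by move=> [A0 AB] Ax; rewrite -sub0r; apply: AB. Qed.

Lemma subgroupD (G : zmodType) (A : set G) x y :
  subgroup A -> A x -> A y -> A (x + y).
Proof.
by move=> sA Ax Ay; rewrite -[y]opprK; apply: sA.2 => //; apply: subgroupN.
Qed.

Lemma subgroupMn (G : zmodType) (A : set G) x n :
  subgroup A -> A x -> A (x *+ n).
Proof.
move=> sA Ax; elim: n => [|n IHn]; first by rewrite mulr0n; apply: sA.1.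
by rewrite mulrS; apply: subgroupD.
Qed.

Lemma subgroupMz (G : zmodType) (A : set G) x (n : int) :
  subgroup A -> A x -> A (x *~ n).
Proof.
move=> sA Ax; case: n => n; first exact: subgroupMn.
by rewrite NegzE mulrNz; apply: subgroupN => //; apply: subgroupMn.
Qed.

Lemma subgroup_sum (G : zmodType) (A : set G) (I : Type) (s : seq I) F :
  subgroup A -> (forall i, A (F i)) -> A (\sum_(i <- s) F i).
Proof.
move=> sA AF; elim: s => [|i s IHs]; first by rewrite big_nil; apply: sA.1.
by rewrite big_cons; apply: subgroupD.
Qed.

Lemma torsion_freeMz (G : zmodType) (x : G) (n : int) :
  torsion_free G -> n != 0 -> x *~ n = 0 -> x = 0.
Proof.
move=> hG n0 xn0; apply: (hG x `|n|%N); first by rewrite absz_gt0.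
case: n n0 xn0 => n // _; rewrite NegzE mulrNz => /eqP.
by rewrite oppr_eq0 => /eqP.
Qed.

Lemma torsion_freeMzI (G : zmodType) (x y : G) (n : int) :
  torsion_free G -> n != 0 -> x *~ n = y *~ n -> x = y.
Proof.
move=> hG n0 /eqP; rewrite -subr_eq0 -mulrzBl => /eqP /(torsion_freeMz hG n0).
by move/eqP; rewrite subr_eq0 => /eqP.
Qed.

Lemma additive_of (U V : zmodType) (f : U -> V) :
  zmod_morphism f -> exists g : {additive U -> V}, g =1 f.
Proof.
move=> fB.
pose g : {additive U -> V} := HB.pack f (GRing.isZmodMorphism.Build U V f fB).
by exists g.
Qed.

(** Injectivity of [v] on [S] makes the chosen preimages unique, hence additive. Additivity of [v]
    is asked on [S] only, so that [v] may be a finitely supported sum. *)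
Lemma lift_additive (U V W : zmodType) (S : set V) (v : V -> W) (k : U -> W) :
    subgroup S -> {in S &, {morph v : x y / x - y}} -> set_inj S v ->
    zmod_morphism k -> (forall x, exists2 y, S y & v y = k x) ->
  exists w : {additive U -> V}, forall x, S (w x) /\ v (w x) = k x.
Proof.
move=> sS vB vI kB /(_ _)/cid2 kS.
pose f x := s2val (kS x).
have fS x : S (f x) by rewrite /f; case: (kS x).
have fk x : v (f x) = k x by rewrite /f; case: (kS x).
have fB : zmod_morphism f.
  move=> x y; apply: vI; rewrite ?inE //; first exact: sS.2.
  by rewrite vB ?inE // !fk kB.
have [w wE] := additive_of fB.
by exists w => x; rewrite wE.
Qed.

(** * Rank 1 groups *)

Definition rank1 (G : zmodType) (R : set G) :=
  (exists2 x, R x & x != 0) /\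
  forall x y, R x -> R y ->
    exists p q : int, (p != 0) || (q != 0) /\ x *~ p = y *~ q.

Lemma has_rank1P (G : zmodType) (R : set G) :
  torsion_free G -> has_rank R 1 <-> rank1 R.
Proof.
move=> hG; split=> [[[v [Rv vI]] Rmax]|[[x Rx x0] Rdep]]; split.
- exists (v ord0) => //; apply/eqP => v0.
  have := vI (fun=> 1); rewrite big_ord1 v0 mul0rz => /(_ erefl ord0).
  by move/eqP.
- move=> x y Rx Ry.
  pose w (i : 'I_2) := if i == ord0 then x else y.
  have Rw i : R (w i) by rewrite /w; case: ifP.
  have /existsNP[c /not_implyP[]] : ~ zindependent w.
    by move=> /(Rmax _ _ Rw).
  rewrite big_ord_recl big_ord1 /w /= => cE /existsNP[i /eqP ci].
  exists (c ord0), (- c (lift ord0 ord0)); split; last first.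
    by apply/eqP; rewrite mulrNz -addr_eq0 cE.
  rewrite oppr_eq0; apply/orP.
  by case: (unliftP ord0 i) ci => [j|] ->; [rewrite ord1; right|left].
- exists (fun=> x); split=> // c; rewrite big_ord1 => xc i.
  rewrite ord1; apply/eqP; apply: contraT => c0.
  by move: x0; rewrite (torsion_freeMz hG c0 xc) eqxx.
- move=> m v Rv vI; rewrite leqNgt; apply/negP => m1.
  pose i0 := Ordinal (ltnW m1); pose i1 := Ordinal m1.
  have [p [q [pq0 pq]]] := Rdep _ _ (Rv i0) (Rv i1).
  pose c i : int := if i == i0 then p else if i == i1 then - q else 0.
  have c0 : forall i, c i = 0.
    apply: vI; rewrite (bigD1 i0) //= (bigD1 i1) //= big1 => [|i].
      by rewrite /c !eqxx /= mulrNz pq addr0 subrr.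
    by rewrite /c => /andP[/negPf-> /negPf->]; rewrite mulr0z.
  have := c0 i0; have := c0 i1; rewrite /c !eqxx /= => /eqP.
  by rewrite oppr_eq0 => /eqP q0 p0; rewrite q0 p0 in pq0.
Qed.

(** Some nonzero multiple of [x] is a multiple of [r], hence killed by [f]. This rigidity lets an
    identity of additive maps on a rank 1 group be checked at one nonzero element. *)
Lemma rank1_additive_eq0 (G V : zmodType) (R : set G)
    (f : {additive G -> V}) r :
    torsion_free G -> torsion_free V -> rank1 R -> R r -> r != 0 -> f r = 0 ->
  forall x, R x -> f x = 0.
Proof.
move=> hG hV [_ Rdep] Rr r0 fr0 x Rx.
have [p [q [pq0 pq]]] := Rdep _ _ Rx Rr.
have [p0|p0] := eqVneq p 0.
  rewrite p0 eqxx /= in pq0; rewrite p0 mulr0z in pq.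
  by move: r0; rewrite (torsion_freeMz hG pq0 (esym pq)) eqxx.
by apply: (torsion_freeMz hV p0); rewrite -raddfMz pq raddfMz fr0 mul0rz.
Qed.

Lemma rank1_bezout (G : zmodType) (R : set G) a b :
    torsion_free G -> subgroup R -> rank1 R -> R a -> R b ->
  exists c : G, R c /\ exists p q u v : int,
    [/\ a = c *~ p, b = c *~ q & c = a *~ u + b *~ v].
Proof.
move=> hG sR [_ Rdep] Ra Rb.
have [p [q [pq0 pq]]] := Rdep _ _ Ra Rb.
have [u [v uv]] := Bezoutz p q.
have g0 : gcdz p q != 0 by rewrite gcdz_eq0 negb_and.
have /dvdzP[p' pE] := dvdz_gcdl p q.
have /dvdzP[q' qE] := dvdz_gcdr p q.
move: (gcdz p q) uv g0 pE qE => g uv g0 pE qE.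
have pq' : a *~ p' = b *~ q'.
  by apply: (torsion_freeMzI hG g0); rewrite -!mulrzA -pE -qE.
have uv' : u * p' + v * q' = 1.
  by apply: (mulIf g0); rewrite mul1r mulrDl -!mulrA -pE -qE.
(* The Bezout coefficients are swapped: [a *~ p' = b *~ q'] turns [c *~ q'] into
   [a *~ (v * q' + u * p')], which is [a], and likewise [c *~ p'] into [b]. *)
exists (a *~ v + b *~ u); split.
  by apply: subgroupD => //; apply: subgroupMz.
exists q', p', v, u; split=> //.
- rewrite mulrzDl -!mulrzA [u * _]mulrC [b *~ _]mulrzA -pq' -mulrzA -mulrzDr.
  by rewrite addrC [p' * u]mulrC uv'.
- rewrite mulrzDl -!mulrzA [v * _]mulrC [a *~ _]mulrzA pq' -mulrzA -mulrzDr.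
  by rewrite addrC [q' * v]mulrC uv'.
Qed.

(** Rank 1 groups are locally cyclic: induction on [s], merging the generator found so far with one
    new element. As [s] has no repetition, setting the coefficient at the new index leaves the
    others alone. *)
Lemma rank1_bezout_seq (G : zmodType) (R : set G) (I : eqType) (s : seq I)
    (r : I -> G) :
    torsion_free G -> subgroup R -> rank1 R -> uniq s ->
    (forall i, R (r i)) ->
  exists c : G, R c /\ exists n m : I -> int,
    (forall i, i \in s -> r i = c *~ n i) /\ c = \sum_(i <- s) r i *~ m i.
Proof.
move=> hG sR rR us Rr; elim: s us => [_|i s IHs /= /andP[nis us]].
  exists 0; split; first exact: sR.1.
  by exists (fun=> 0), (fun=> 0); rewrite big_nil.
have [c [Rc [n [m [rn cm]]]]] := IHs us.
have [d [Rd [p [q [u [v [rE cE dE]]]]]]] := rank1_bezout hG sR rR (Rr i) Rc.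
exists d; split=> //.
exists (fun k => if k == i then p else q * n k).
exists (fun k => if k == i then u else m k * v); split.
  move=> k; rewrite inE; case: eqP => [-> //|_ /= ks].
  by rewrite (rn k ks) {1}cE mulrzA.
rewrite big_cons eqxx dE {1}cm; congr (_ + _).
rewrite mulrz_suml !big_seq; apply: eq_bigr => k ks.
by case: eqP => [ki|_]; [rewrite -ki ks in nis|rewrite mulrzA].
Qed.

(** * Isomorphism of rank 1 summands *)

(** Both maps are endomorphisms of [G], so that they compose with projections; between direct
    summands every isomorphism extends in this way. *)
Definition summand_iso (G : zmodType) (A B : set G) : Prop :=
  exists u v : {additive G -> G},
    (forall x, A x -> B (u x) /\ v (u x) = x) /\
    (forall y, B y -> A (v y) /\ u (v y) = y).

Lemma summand_iso_refl (G : zmodType) (A : set G) : summand_iso A A.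
Proof. by exists idfun, idfun. Qed.

Lemma summand_iso_sym (G : zmodType) (A B : set G) :
  summand_iso A B -> summand_iso B A.
Proof. by move=> [u [v [uv vu]]]; exists v, u. Qed.

Lemma summand_iso_trans (G : zmodType) (A B C : set G) :
  summand_iso A B -> summand_iso B C -> summand_iso A C.
Proof.
move=> [u [v [uv vu]]] [w [z [wz zw]]].
exists (w \o u), (v \o z); split=> x Xx /=.
  have [Bu vux] := uv _ Xx; have [Cw zwx] := wz _ Bu.
  by rewrite zwx.
have [Bz wzx] := zw _ Xx; have [Av uvx] := vu _ Bz.
by rewrite uvx.
Qed.

(* The image of [v] is a subgroup of [R] containing some [N R], [N > 0]; since
   [R] is locally cyclic, it is [d R] for [d] the exponent of the quotient. *)
Lemma rank1_summand_iso (G : zmodType) (R S : set G)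
    (pR pS u v : {additive G -> G}) r0 :
    torsion_free G -> subgroup R -> rank1 R -> subgroup S -> rank1 S ->
    (forall x, R (pR x)) -> (forall x, R x -> pR x = x) ->
    (forall x, S (pS x)) -> (forall x, S x -> pS x = x) ->
    (forall x, R x -> S (u x)) -> (forall x, S x -> R (v x)) ->
    R r0 -> v (u r0) != 0 ->
  summand_iso R S.
Proof.
move=> hG sR rR sS rS RpR pRid SpS pSid Ru Sv Rr0 vu0.
have r0n0 : r0 != 0 by apply: contraNneq vu0 => ->; rewrite !raddf0.
have vI : set_inj S v.
  move=> x y /set_mem Sx /set_mem Sy vxy; apply/eqP; rewrite -subr_eq0.
  apply: contraNT vu0 => xy0; apply/eqP.
  apply: (rank1_additive_eq0 hG hG rS (sS.2 _ _ Sx Sy) xy0); last exact: Ru.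
  by rewrite raddfB vxy subrr.
pose T x n := exists2 y, S y & v y = x *+ n.
(* A relation [v (u r0) *~ a = r0 *~ b] with [b] nonzero spreads to all of [R] by rigidity, so [N]
   can be the absolute value of [b]. *)
have [N N0 TN] : exists2 N, (0 < N)%N & forall x, R x -> T x N.
  have [a [b [ab0 ab]]] := rR.2 _ _ (Sv _ (Ru _ Rr0)) Rr0.
  have b0 : b != 0.
    apply/eqP => b0; rewrite b0 eqxx orbF in ab0; rewrite b0 mulr0z in ab.
    by move: vu0; rewrite (torsion_freeMz hG ab0 ab) eqxx.
  have fB : zmod_morphism (fun x => v (u x) *~ a - x *~ b).
    by move=> x y /=; rewrite !raddfB !mulrzBl !opprD !opprK addrACA.
  have [f fE] := additive_of fB.
  have f0 x : R x -> v (u x) *~ a = x *~ b.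
    move=> Rx; apply/eqP; rewrite -subr_eq0 -fE; apply/eqP.
    by apply: (rank1_additive_eq0 hG hG rR Rr0 r0n0) => //; rewrite fE ab subrr.
  exists `|b|%N; first by rewrite absz_gt0.
  move=> x Rx; move: (f0 x Rx); clear ab0 ab f0 fE fB b0; case: b => b xb.
    by exists (u x *~ a); [apply: subgroupMz; auto|rewrite raddfMz xb].
  exists (u x *~ - a); first by apply: subgroupMz; auto.
  by rewrite raddfMz mulrNz xb NegzE mulrNz opprK.
have TM x c n : T x n -> T (x *~ c) n.
  move=> [y Sy vy]; exists (y *~ c); first exact: subgroupMz.
  by rewrite raddfMz vy !pmulrn -!mulrzA mulrC.
(* [d] is the order of [x] modulo the image of [S] under [v]. *)
pose o x d := [/\ (0 < d)%N, T x d & forall n, T x n -> (d %| n)%N].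
have oE x : R x -> exists d, o x d.
  move=> Rx.
  have exT : exists n, (0 < n)%N && `[< T x n >].
    by exists N; rewrite N0; apply/asboolP; apply: TN.
  exists (ex_minn exT); case: ex_minnP => d /andP[d0 /asboolP[y Sy vy]] dmin.
  split=> //; first by exists y.
  move=> n [z Sz vz]; rewrite /dvdn; apply: contraT; rewrite -lt0n => r0'.
  suff /dmin : (0 < n %% d)%N && `[< T x (n %% d)%N >].
    by rewrite leqNgt ltn_mod d0.
  rewrite r0'; apply/asboolP; exists (z - y *+ (n %/ d)%N).
    by apply: sS.2 => //; apply: subgroupMn.
  rewrite raddfB raddfMn vy vz {1}(divn_eq n d) mulrnDr -mulrnA.
  by rewrite [(d * _)%N]mulnC addrAC subrr add0r.
have exd : exists d, `[< exists2 t, R t & o t d >].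
  by have [d od] := oE _ Rr0; exists d; apply/asboolP; exists r0.
have dN d : `[< exists2 t, R t & o t d >] -> (d <= N)%N.
  by move=> /asboolP[t Rt [d0 _ /(_ _ (TN t Rt))]]; apply: dvdn_leq.
(* Orders are bounded by [N]; [t] has the largest one, [d]. *)
case: (ex_maxnP exd dN) => d /asboolP[t Rt [d0 Tt dt]] dmax {exd dN}.
(* [x] and [t] are multiples of one [c]. The order of [c] is a multiple of [d] because [t] is a
   multiple of [c], and maximality makes it equal to [d]. *)
have common x : R x -> exists c m, [/\ R c, x = c *~ m & o c d].
  move=> Rx.
  have [c [Rc [m [k [_ [_ [xE tE _]]]]]]] := rank1_bezout hG sR rR Rx Rt.
  exists c, m; split=> //.
  have [e oe] := oE _ Rc; case: (oe) => e0 Te eT.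
  have de : (d %| e)%N by apply: dt; rewrite tE; apply: TM.
  have /dmax ed : `[< exists2 t, R t & o t e >] by apply/asboolP; exists c.
  suff -> : d = e by [].
  by apply/eqP; rewrite eqn_leq ed dvdn_leq.
(* The isomorphism is multiplication by [d] followed by the inverse of [v]; its inverse [w2] is [v]
   followed by division by [d]. *)
have [w1 w1E] : exists w : {additive G -> G},
    forall x, S (w x) /\ v (w x) = pR x *+ d.
  apply: lift_additive => //.
  - by move=> x y _ _; rewrite raddfB.
  - by move=> x y; rewrite raddfB mulrnBl.
  - move=> x; have [c [m [Rc -> [_ Tc _]]]] := common _ (RpR x).
    exact: TM.
have [w2 w2E] : exists w : {additive G -> G},
    forall x, R (w x) /\ w x *+ d = v (pS x).
  apply: (lift_additive (v := fun x => x *+ d) (k := v \o pS)) => //=.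
  - by move=> x y _ _; rewrite mulrnBl.
  - move=> x y _ _ xy; apply: (torsion_freeMzI hG (n := d)) => //.
    by rewrite -lt0n.
  - by move=> x y /=; rewrite !raddfB.
  - move=> x; have [c [m [Rc vx [_ Tc dc]]]] := common _ (Sv _ (SpS x)).
    have /dc/dvdnP[k mk] : T c `|m|%N.
      case: m vx => m vx; first by exists (pS x).
      exists (- pS x); first exact: subgroupN.
      by rewrite raddfN vx NegzE mulrNz opprK.
    exists (c *~ (sgz m * k%:Z)); first exact: subgroupMz.
    rewrite vx pmulrn -mulrzA -mulrA -PoszM -mk; congr (_ *~ _).
    by rewrite abszE mulr_sg_norm.
exists w1, w2; split.
  move=> x Rx; have [Sx vx] := w1E x; split=> //.
  have [_ wx] := w2E (w1 x); apply: (torsion_freeMzI hG (n := d)).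
    by rewrite -lt0n.
  by rewrite -!pmulrn wx pSid // vx pRid.
move=> y Sy; have [Ry wy] := w2E y; split=> //.
have [Sx vx] := w1E (w2 y); apply: vI; rewrite ?inE //.
by rewrite vx pRid // wy pSid.
Qed.

(** * Decompositions by coordinates and the retract argument *)

(** All projections are endomorphisms of [G], and finite support is witnessed by a sequence. The
    image of [q], inside [H], is the complement of the sum of the [B i]. *)
Record rank1_decomposition (G : zmodType) (I : choiceType) (B : I -> set G)
    (H : set G) (p : I -> {additive G -> G}) (q : {additive G -> G}) : Prop :=
  Rank1Decomposition {
    dec_subgroup : forall i, subgroup (B i);
    dec_rank1 : forall i, rank1 (B i);
    dec_subgroup_rest : subgroup H;
    dec_proj_in : forall i x, B i (p i x);
    dec_rest_in : forall x, H (q x);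
    dec_proj_id : forall i x, B i x -> p i x = x;
    dec_proj0 : forall i j x, B i x -> j != i -> p j x = 0;
    dec_rest0 : forall i x, B i x -> q x = 0;
    dec_sum : forall x, exists s : seq I,
      [/\ uniq s, forall i, p i x != 0 -> i \in s &
          x = \sum_(i <- s) p i x + q x] }.

Lemma dec_assemble (G : zmodType) (I : choiceType) (B : I -> set G) (H : set G)
    (p : I -> {additive G -> G}) (q : {additive G -> G}) (s : seq I)
    (b : I -> G) :
    rank1_decomposition B H p q -> uniq s -> (forall i, B i (b i)) ->
    (forall i, b i != 0 -> i \in s) ->
  exists x, q x = 0 /\ forall i, p i x = b i.
Proof.
move=> D us Bb bs; exists (\sum_(i <- s) b i); split.
  by rewrite raddf_sum big1 // => i _; apply: (dec_rest0 D (Bb i)).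
move=> i; rewrite raddf_sum; have [si|si] := boolP (i \in s).
  rewrite (bigD1_seq i) //= (dec_proj_id D (Bb i)) big1 ?addr0 // => j ji.
  by rewrite (dec_proj0 D (Bb j)) // eq_sym.
have -> : b i = 0 by apply/eqP; apply: contraNT si; apply: bs.
rewrite big_seq big1 // => j sj; apply: (dec_proj0 D (Bb j)).
by apply: contraNneq si => ->.
Qed.

Lemma dec_ext (G : zmodType) (I : choiceType) (B : I -> set G) (H : set G)
    (p : I -> {additive G -> G}) (q : {additive G -> G}) x y :
    rank1_decomposition B H p q -> q x = q y -> (forall i, p i x = p i y) ->
  x = y.
Proof.
move=> D qE pE; apply/eqP; rewrite -subr_eq0; apply/eqP.
have [s [_ _ ->]] := dec_sum D (x - y).
rewrite raddfB qE subrr addr0 big1 // => i _.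
by rewrite raddfB pE subrr.
Qed.

(* Here [g] and [f] exhibit [R] as a retract of [G]; were [f] to kill every
   [p j y], the retraction would factor through [H] and split off a copy of [R]
   there. *)
Lemma retract_meets_decomposition (G : zmodType) (J : choiceType)
    (B : J -> set G) (H : set G) (p : J -> {additive G -> G})
    (q : {additive G -> G}) (R : set G) (pR g f : {additive G -> G}) r y :
    torsion_free G -> rank1_decomposition B H p q -> clipped H ->
    subgroup R -> rank1 R ->
    (forall x, R (pR x)) -> (forall x, R x -> pR x = x) ->
    (forall x, R (f x)) -> R r -> r != 0 -> g r = y -> f y = r ->
  exists j, p j y != 0 /\ summand_iso R (B j).
Proof.
move=> hG D hH sR rR RpR pRid Rf Rr r0 gr fy.
have [[j fj]|nf] := pselect (exists j, f (p j y) != 0).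
  exists j; split; first by apply: contraNneq fj => ->; rewrite raddf0.
  apply: (rank1_summand_iso (pR := pR) (pS := p j) (u := p j \o g)
    (v := f) (r0 := r)) => //=.
  - exact: dec_subgroup D j.
  - exact: dec_rank1 D j.
  - by move=> x; apply: dec_proj_in D j x.
  - by move=> x; apply: dec_proj_id D j x.
  - by move=> x _; apply: dec_proj_in D j _.
  - by rewrite gr.
(* Apply [f] to the decomposition of [y]: only the [q] term survives. *)
have fq : f (q (g r)) = r.
  have [s [_ _ yE]] := dec_sum D y.
  rewrite gr -[RHS]fy [in RHS]yE raddfD raddf_sum big1 ?add0r // => j _.
  by apply/eqP; apply: contrapT => /negP fj; apply: nf; exists j.
have fqg x : R x -> f (q (g x)) = x.
  have hB : zmod_morphism (fun x => f (q (g x)) - x).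
    move=> a b /=; rewrite (raddfB g) (raddfB q) (raddfB f).
    by rewrite !opprD !opprK addrACA.
  have [h hE] := additive_of hB.
  move=> Rx; apply/eqP; rewrite -subr_eq0 -hE; apply/eqP.
  by apply: (rank1_additive_eq0 hG hG rR Rr r0) => //; rewrite hE fq subrr.
(* Since [f] inverts [q \o g] on [R], the image and the kernel of [q \o g \o f] on [H] are
   complementary; the image is a copy of [R]. *)
case: hH; exists [set q (g x) | x in R], [set x | H x /\ f x = 0].
have sK : subgroup [set q (g x) | x in R].
  split; first by exists 0; [exact: sR.1|rewrite !raddf0].
  move=> _ _ [a Ra <-] [b Rb <-]; exists (a - b); first exact: sR.2.
  by rewrite !raddfB.
have sH := dec_subgroup_rest D.
split.
  split=> //.
    split; first by split; [exact: sH.1|rewrite raddf0].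
    move=> a b [Ha fa] [Hb fb]; split; first exact: sH.2.
    by rewrite raddfB fa fb subrr.
  split.
  - move=> [_ l] [[a Ra <-] [/= Hl _]]; apply: subgroupD => //.
    exact: dec_rest_in D _.
  - move=> [k l] [k' l'] /set_mem[/= [a Ra <-] [_ fl]].
    move=> /set_mem[/= [b Rb <-] [_ fl']] E.
    have ab : a = b.
      by have := congr1 f E; rewrite !raddfD fl fl' !addr0 !fqg.
    by move: E; rewrite ab => /addrI ->.
  - move=> x Hx; exists (q (g (f x)), x - q (g (f x))) => /=.
      split=> /=; first by exists (f x).
      split; last by rewrite raddfB fqg // subrr.
      by apply: sH.2 => //; apply: dec_rest_in D _.
    by rewrite addrC subrK.
apply/(has_rank1P _ hG); split.
  exists (q (g r)); first by exists r.
  by apply: contraNneq r0 => E; rewrite -fq E raddf0.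
move=> _ _ [a Ra <-] [b Rb <-].
have [m [n [mn0 mn]]] := rR.2 _ _ Ra Rb.
by exists m, n; split=> //; rewrite -!raddfMz mn.
Qed.

(** Transported into [B i], the nonzero coordinates of [y] generate a cyclic group. Multiples of its
    generator [r] rebuild them, which gives [g] from [r] to [y]; the Bezout coefficients recover
    [r], which gives [f] back from [y]. *)
Lemma homogeneous_meets_decomposition (G : zmodType) (I J : choiceType)
    (B : I -> set G) (H : set G) (p : I -> {additive G -> G})
    (q : {additive G -> G}) (B' : J -> set G) (H' : set G)
    (p' : J -> {additive G -> G}) (q' : {additive G -> G}) i y :
    torsion_free G -> rank1_decomposition B H p q ->
    rank1_decomposition B' H' p' q' -> clipped H' ->
    q y = 0 -> p i y != 0 ->
    (forall k, p k y != 0 -> summand_iso (B i) (B k)) ->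
  exists j, p' j y != 0 /\ summand_iso (B i) (B' j).
Proof.
move=> hG D D' hH' qy piy ysupp.
have [s [us sy yE]] := dec_sum D y; rewrite qy addr0 in yE.
have /choice[uv uvE] k : exists uv : {additive G -> G} * {additive G -> G},
    (forall x, B i (uv.2 (p k x))) /\ (p k y != 0 ->
      (forall x, B i x -> B k (uv.1 x)) /\
      uv.1 (uv.2 (p k y)) = p k y).
  have [pky|pky] := eqVneq (p k y) 0.
    (* Zero maps where the coordinate vanishes keep every second component valued in [B i], hence
       [f] too. *)
    exists (\0 : {additive G -> G}, \0 : {additive G -> G}).
    by split=> // x; apply: (dec_subgroup D i).1.
  have [u [v [uv vu]]] := ysupp _ pky.
  exists (u, v); split=> /= [x|_].
    by have [] := vu _ (dec_proj_in D k x).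
  split; first by move=> x /uv[].
  by have [] := vu _ (dec_proj_in D k y).
have [r [Br [n [m [rn rm]]]]] :=
  rank1_bezout_seq (r := fun k => (uv k).2 (p k y)) hG (dec_subgroup D i)
    (dec_rank1 D i) us (fun k => (uvE k).1 y).
have gB : zmod_morphism (fun x => \sum_(k <- s | p k y != 0) (uv k).1 x *~ n k).
  move=> a b /=; rewrite -sumrB; apply: eq_bigr => k _.
  by rewrite raddfB mulrzBl.
have fB : zmod_morphism (fun x => \sum_(k <- s) (uv k).2 (p k x) *~ m k).
  move=> a b /=; rewrite -sumrB; apply: eq_bigr => k _.
  by rewrite !raddfB mulrzBl.
have [g gE] := additive_of gB; have [f fE] := additive_of fB.
have gr : g r = y.
  rewrite gE [RHS]yE [RHS](bigID (fun k => p k y != 0)) /=.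
  rewrite [X in _ + X]big1 ?addr0; last by move=> k; rewrite negbK => /eqP.
  rewrite big_seq_cond [RHS]big_seq_cond; apply: eq_bigr => k /andP[ks pky].
  by rewrite -raddfMz -rn // ((uvE k).2 pky).2.
have fy : f y = r by rewrite fE -rm.
apply: (retract_meets_decomposition (pR := p i) (g := g) (f := f) (r := r)
  hG D') => //.
- exact: dec_subgroup D i.
- exact: dec_rank1 D i.
- by move=> x; apply: dec_proj_in D i x.
- by move=> x; apply: dec_proj_id D i x.
- move=> x; rewrite fE; apply: subgroup_sum; first exact: dec_subgroup D i.
  move=> k; apply: subgroupMz; first exact: dec_subgroup D i.
  exact: (uvE k).1.
- by apply: contraNneq piy => r0; rewrite -gr r0 !raddf0.
Qed.

(** * Well-orders and Gaussian elimination *)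

(** Least elements of pairs give totality and, by their uniqueness, antisymmetry; least elements of
    triples give transitivity. *)
Lemma exists_well_order (T : eqType) : exists R : rel T,
  [/\ antisymmetric R, transitive R, total R &
      forall P : set T, P !=set0 -> exists2 x, P x & forall y, P y -> R x y].
Proof.
have [R wo] := well_ordering_principle T; exists R.
have woP (P : set T) :
    P !=set0 -> exists2 x, P x & forall y, P y -> R x y.
  move=> [x Px]; have := wo [pred y | `[< P y >]].
  case=> [|z [[/asboolP Pz zmin] _]]; first by exists x; apply/asboolP.
  by exists z => // y Py; apply: zmin; apply/asboolP.
have Rtot : total R.
  move=> x y.
  have [z /= zE zmin] := woP [set x; y] (ex_intro _ x (or_introl erefl)).
  case: zE zmin => -> zmin; first by rewrite zmin //; right.
  by rewrite orbC zmin //; left.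
have Rxx x : R x x by have := Rtot x x; rewrite orbb.
have Rasym : antisymmetric R.
  move=> x y /andP[xy yx].
  have [|z [_ zu]] := wo (pred2 x y); first by exists x; rewrite !inE eqxx.
  rewrite -(zu x); first rewrite -(zu y) //.
    split; first by rewrite !inE eqxx orbT.
    by move=> w; rewrite !inE => /orP[]/eqP->.
  split; first by rewrite !inE eqxx.
  by move=> w; rewrite !inE => /orP[]/eqP->.
split=> // y x z xy yz.
have [w /= wE wmin] := woP [set x; y; z]
  (ex_intro _ y (or_introl (or_intror erefl))).
case: wE wmin => [[]|] -> wmin.
- by apply: wmin; right.
- have -> // : x = y by apply: Rasym; rewrite xy wmin //; left; left.
- by have <- // : y = z by apply: Rasym; rewrite yz wmin //; left; right.
Qed.

Lemma seq_maximum (T : eqType) (R : rel T) (P : set T) (s : seq T) :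
    transitive R -> total R -> (exists2 x, P x & x \in s) ->
  exists2 x, P x & forall y, P y -> y \in s -> R y x.
Proof.
move=> Rtr Rtot; elim: s => [[x _]|a s IHs [x Px]]; first by rewrite in_nil.
have Rxx z : R z z by have := Rtot z z; rewrite orbb.
have [[z Pz zs]|nPs] := pselect (exists2 x, P x & x \in s).
  have [w Pw wmax] := IHs (ex_intro2 _ _ z Pz zs).
  have [Pa|nPa] := pselect (P a); last first.
    exists w => // y Py; rewrite inE => /orP[/eqP ya|]; last exact: wmax.
    by rewrite ya in Py.
  move=> _; have /orP[aw|wa] := Rtot a w; [exists w => //|exists a => //];
    move=> y Py; rewrite inE => /orP[/eqP -> //|ys].
    exact: wmax.
  by apply: Rtr wa; apply: wmax.
rewrite inE => /orP[/eqP xa|xs]; last by case: nPs; exists x.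
exists x => // y Py; rewrite inE -xa => /orP[/eqP -> //|ys].
by case: nPs; exists y.
Qed.

(* Gaussian elimination: [i] is sent to the least leading index, with respect
   to the second decomposition, of a vector of the [B i]-homogeneous part whose
   top index in the first decomposition is [i]. *)
Lemma homogeneous_injection (G : zmodType) (I J : choiceType)
    (B : I -> set G) (H : set G) (p : I -> {additive G -> G})
    (q : {additive G -> G}) (B' : J -> set G) (H' : set G)
    (p' : J -> {additive G -> G}) (q' : {additive G -> G}) :
    torsion_free G -> rank1_decomposition B H p q ->
    rank1_decomposition B' H' p' q' -> clipped H' ->
  exists2 h : I -> J, injective h & forall i, summand_iso (B i) (B' (h i)).
Proof.
move=> hG D D' hH'.
have [leI [leIasym leItr leItot _]] := exists_well_order I.
have [leJ [leJasym leJtr leJtot leJwo]] := exists_well_order J.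
(* Vectors of the [B i]-homogeneous part with top index [i]. *)
pose V i y := [/\ q y = 0, p i y != 0 &
  forall k, p k y != 0 -> leI k i /\ summand_iso (B i) (B k)].
(* Only coordinates in copies of [B i] compete for the leading index, as [y] may have others in the
   second decomposition. *)
pose lead i y j := [/\ p' j y != 0, summand_iso (B i) (B' j) &
  forall k, p' k y != 0 -> summand_iso (B i) (B' k) -> leJ k j].
have V_lead i y : V i y -> exists j, lead i y j.
  move=> [qy piy ysupp].
  have [j [pj Bj]] := homogeneous_meets_decomposition hG D D' hH' qy piy
    (fun k pky => (ysupp k pky).2).
  have [s [_ sy _]] := dec_sum D' y.
  have [k [pk Bk] kmax] := seq_maximum
    (P := [set j | p' j y != 0 /\ summand_iso (B i) (B' j)]) (s := s)
    leJtr leJtot (ex_intro2 _ _ j (conj pj Bj) (sy _ pj)).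
  by exists k; split=> // l pl Bl; apply: kmax (sy _ pl).
have V_ne i : exists y, V i y.
  have [[y By y0] _] := dec_rank1 D i; exists y; split.
  - exact: (dec_rest0 D By).
  - by rewrite (dec_proj_id D).
  - move=> k; have [-> _|ki] := eqVneq k i.
      split; last exact: summand_iso_refl.
      by have := leItot i i; rewrite orbb.
    by rewrite (dec_proj0 D By) // eqxx.
have /choice[h hP] i : exists j, (exists2 y, V i y & lead i y j) /\
    forall k y, V i y -> lead i y k -> leJ j k.
  have [y Vy] := V_ne i; have [j lj] := V_lead i y Vy.
  have [k [z Vz lz] kmin] := leJwo [set j | exists2 y, V i y & lead i y j]
    (ex_intro _ j (ex_intro2 _ _ y Vy lj)).
  by exists k; split; [exists z|move=> l w Vw lw; apply: kmin; exists w].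
have hB i : summand_iso (B i) (B' (h i)).
  by have [[y _ []]] := hP i.
exists h => //.
suff lt_neq i k : leI k i -> k != i -> h i <> h k.
  move=> i k ik; apply/eqP; apply: contraT => nik.
  have /orP[le|le] := leItot i k; first by case: (lt_neq k i le nik).
  by case: (lt_neq i k le); rewrite // eq_sym.
move=> ki nki hik.
have [[y [qy piy ysupp] [hy _ ymax]] hmin] := hP i.
have [[z [qz pkz zsupp] [hz _ zmax]] _] := hP k.
have Bik : summand_iso (B i) (B k).
  by apply: summand_iso_trans (hB i) _; rewrite hik; apply: summand_iso_sym.
(* Elimination: the combination [x] of [y] and [z] cancels the coordinate at [h i], and keeps top
   index [i] because [m] is nonzero and [z] has its top index [k] strictly below [i]. *)
have [m [n [mn0 mn]]] := (dec_rank1 D' (h i)).2 _ _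
  (dec_proj_in D' (h i) y) (dec_proj_in D' (h i) z).
have m0 : m != 0.
  move: mn0; have [m0|//] := eqVneq m 0; rewrite m0 mulr0z in mn => /= n0.
  by move: hz; rewrite -hik (torsion_freeMz hG n0 (esym mn)) eqxx.
pose x := y *~ m - z *~ n.
have xE (f : {additive G -> G}) : f x = f y *~ m - f z *~ n.
  by rewrite /x (raddfB f) !(raddfMz f).
have pz0 : p i z = 0.
  apply/eqP; apply: contraT => /zsupp[ik _].
  by rewrite (leIasym k i) ?eqxx ?ki // in nki.
have Vx : V i x.
  split.
  - by rewrite xE qy qz !mul0rz subrr.
  - rewrite xE pz0 mul0rz subr0.
    by apply: contraNneq piy => /(torsion_freeMz hG m0) ->.
  - move=> l; have [ly|/ysupp//] := eqVneq (p l y) 0.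
    have [lz|/zsupp[lk Bl] _] := eqVneq (p l z) 0.
      by rewrite xE ly lz !mul0rz subrr eqxx.
    split; last exact: summand_iso_trans Bik Bl.
    exact: leItr lk ki.
have [j lj] := V_lead _ _ Vx.
have hj := hmin _ _ Vx lj.
have [jx Bj _] := lj.
(* A nonzero coordinate of [x] comes from [y] or [z], so its leading index is at most [h i].
   Minimality of [h i] forces equality, but [x] vanishes there. *)
have jh : leJ j (h i).
  have [jy|jy] := eqVneq (p' j y) 0; last exact: ymax.
  have [jz|jz] := eqVneq (p' j z) 0.
    by move: jx; rewrite xE jy jz !mul0rz subrr eqxx.
  rewrite hik; apply: zmax => //; apply: summand_iso_trans Bj.
  exact: summand_iso_sym.
move: jx; rewrite (leJasym j (h i)) ?jh //.
by rewrite xE mn subrr eqxx.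
Qed.

(** * Projections of internal direct sums *)

Lemma direct_sum2_proj (G : zmodType) (A H : set G) :
    direct_sum2 [set: G] A H ->
  exists a q : {additive G -> G},
    [/\ forall x, A (a x), forall x, H (q x), forall x, a x + q x = x &
        forall x, A x -> a x = x /\ q x = 0].
Proof.
move=> [sA sH [_ addI addS]].
have [w wE] : exists w : {additive G -> G * G},
    forall x, (A `*` H) (w x) /\ (w x).1 + (w x).2 = x.
  apply: (lift_additive (v := fun z : G * G => z.1 + z.2) (k := id)) => //.
  - split; first by split; [exact: sA.1|exact: sH.1].
    by move=> x y [Ax Hx] [Ay Hy]; split; [exact: sA.2|exact: sH.2].
  - by move=> x y _ _ /=; rewrite opprD addrACA.
  - by move=> x; have [z Az zx] := addS x I; exists z.
have wI x y z : A x -> H y -> x + y = z -> w z = (x, y).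
  move=> Ax Hy xyz; apply: addI; rewrite ?inE //; last first.
    by rewrite (wE z).2 xyz.
  by have [] := wE z.
have aB : zmod_morphism (fun x => (w x).1) by move=> x y; rewrite raddfB.
have qB : zmod_morphism (fun x => (w x).2) by move=> x y; rewrite raddfB.
have [a aE] := additive_of aB; have [q qE] := additive_of qB.
exists a, q; split=> x; rewrite ?aE ?qE; try by have [[]] := wE x.
by move=> Ax; rewrite (wI x 0 x) ?addr0 //; apply: sH.1.
Qed.

(** The coordinates invert the summation bijection on finitely supported functions; composing with
    [a] first makes them endomorphisms of [G]. *)
Lemma direct_sum_proj (G : zmodType) (I : choiceType) (A : set G)
    (B : I -> set G) (a : {additive G -> G}) :
    direct_sum A B -> (forall x, A (a x)) -> (forall x, A x -> a x = x) ->
  (forall i, B i `<=` A) /\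
  exists p : I -> {additive G -> G},
    [/\ forall i x, B i (p i x), forall i x, B i x -> p i x = x,
        forall i j x, B i x -> j != i -> p j x = 0 &
        forall x, exists s : seq I,
          [/\ uniq s, forall i, p i x != 0 -> i \in s &
              a x = \sum_(i <- s) p i x]].
Proof.
move=> [sB [sumA sumI sumS]] Aa aid.
set S := [set f : I -> G | (forall i, B i (f i)) /\
  finite_set [set i | f i != 0]] in sumA sumI sumS.
have sS : subgroup S.
  split.
    split=> [i|]; first exact: (sB i).1.
    by apply: sub_finite_set (finite_set0 I) => i /=; rewrite eqxx.
  move=> f g [Bf ff] [Bg fg]; split=> [i|]; first exact: (sB i).2.
  have: finite_set ([set i | f i != 0] `|` [set i | g i != 0]).
    by rewrite finite_setU.
  apply: sub_finite_set => i /=; have [fi|fi] := eqVneq (f i) 0; last by left.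
  by have [gi|gi] := eqVneq (g i) 0; [rewrite !fctE fi gi subrr eqxx|right].
have sumE (f : I -> G) s : uniq s -> (forall i, f i != 0 -> i \in s) ->
    \sum_(i \in [set: I]) f i = \sum_(i <- s) f i.
  move=> us fs; rewrite (fsbigE s) => // [|i _ si].
    by apply: eq_bigl => i; rewrite in_setT.
  by apply/eqP; apply: contraNT si; apply: fs.
have supp f : S f -> exists s : seq I, uniq s /\ forall i, f i != 0 -> i \in s.
  move=> [_ /finite_seqP[s fs]]; exists (undup s); rewrite undup_uniq.
  by split=> // i fi; rewrite mem_undup; have : [set i | f i != 0] i by [];
    rewrite fs.
have supp2 f g : S f -> S g -> exists s : seq I, [/\ uniq s,
    forall i, f i != 0 -> i \in s & forall i, g i != 0 -> i \in s].
  move=> /supp[s [us fs]] /supp[t [ut gt]]; exists (undup (s ++ t)).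
  rewrite undup_uniq; split=> // i ?; rewrite mem_undup mem_cat.
    by rewrite fs.
  by rewrite gt ?orbT.
have [w wE] : exists w : {additive G -> (I -> G)},
    forall x, S (w x) /\ \sum_(i \in [set: I]) w x i = a x.
  apply: (lift_additive (v := fun f : I -> G => \sum_(i \in [set: I]) f i)
    (k := a)) => //.
  - move=> f g /set_mem Sf /set_mem Sg.
    have [s [us fs gs]] := supp2 _ _ Sf Sg.
    rewrite !(sumE _ s) // -?sumrB // => i.
    have [fi|/fs//] := eqVneq (f i) 0.
    by have [gi|/gs//] := eqVneq (g i) 0; rewrite !fctE fi gi subrr eqxx.
  - by move=> x y; rewrite raddfB.
  - by move=> x; have [f Sf fx] := sumS _ (Aa x); exists f.
have wI x f : S f -> \sum_(i \in [set: I]) f i = a x -> w x = f.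
  move=> Sf fx; apply: sumI; rewrite ?inE //; first by have [] := wE x.
  by rewrite (wE x).2.
(* By uniqueness, the coordinates of an element of [B i] are concentrated at [i]; this gives the
   relations between projections. *)
pose single i x : I -> G := fun j => if j == i then x else 0.
have Ssingle i x : B i x -> S (single i x).
  move=> Bx; split=> [j|]; rewrite /single.
    by case: eqP => [->//|_]; apply: (sB j).1.
  apply: sub_finite_set (finite_set1 i) => j /=.
  by case: (eqVneq j i) => [->|_]; rewrite ?eqxx.
have sum_single i x : \sum_(j \in [set: I]) single i x j = x.
  rewrite (sumE _ [:: i]) // ?big_seq1 /single ?eqxx // => j.
  by rewrite inE; case: (j == i); rewrite ?eqxx.
have BA i : B i `<=` A.
  by move=> x Bx; rewrite -(sum_single i x); apply: sumA; apply: Ssingle.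
have w_single i x : B i x -> w x = single i x.
  move=> Bx; apply: wI; first exact: Ssingle.
  by rewrite sum_single aid //; apply: BA Bx.
split=> //.
have /choice[p pE] i : exists p : {additive G -> G}, p =1 fun x => w x i.
  by apply: additive_of => x y; rewrite raddfB.
exists p; split.
- by move=> i x; rewrite pE; have [[]] := wE x.
- by move=> i x Bx; rewrite pE (w_single i) // /single eqxx.
- by move=> i j x Bx /negPf ji; rewrite pE (w_single i) // /single ji.
- move=> x; have [Sw wx] := wE x; have [s [us ws]] := supp _ Sw.
  exists s; split=> // [i|]; first by rewrite pE; apply: ws.
  by rewrite -wx (sumE _ s) //; apply: eq_bigr => i _; rewrite pE.
Qed.

Lemma direct_sum2_decomposition (G : zmodType) (A H : set G) :
    torsion_free G -> direct_sum2 [set: G] A H -> completely_decomposable A ->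
  exists (I : choiceType) (B : I -> set G) (p : I -> {additive G -> G})
      (q : {additive G -> G}),
    rank1_decomposition B H p q /\ A = [set x | q x = 0].
Proof.
move=> hG hdec [I [B [B1 hB]]].
have [a [q [Aa Hq aq Aaq]]] := direct_sum2_proj hdec.
have [BA [p [Bp pid pne psum]]] :=
  direct_sum_proj hB Aa (fun x Ax => (Aaq x Ax).1).
have [sA sH _] := hdec.
exists I, B, p, q; split.
  split=> //.
  - exact: hB.1.
  - by move=> i; apply/(has_rank1P _ hG).
  - by move=> i x /BA /Aaq[].
  - move=> x; have [s [us ps ax]] := psum x; exists s; split=> //.
    by rewrite -ax aq.
apply/seteqP; split=> [x /Aaq[]//|x /= qx].
by rewrite -(aq x) qx addr0.
Qed.

(** * Matching the index sets *)

(** The classical bijection sends [i] to [f i] or to its preimage under [g], so it inherits [E] from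
    both injections. *)
Lemma schroeder_bernstein (I J : Type) (E : I -> J -> Prop) (f : I -> J)
    (g : J -> I) :
    injective f -> injective g -> (forall i, E i (f i)) ->
    (forall j, E (g j) j) ->
  exists h k, [/\ cancel h k, cancel k h & forall i, E i (h i)].
Proof.
move=> fI gI Ef Eg.
(* Indices whose backward orbit under [g \o f] reaches a point outside the image of [g]; there [h]
   must be [f]. *)
pose C i := exists n i0, (forall j, g j <> i0) /\ iter n (g \o f) i0 = i.
have /choice[h hP] i : exists j, (C i /\ j = f i) \/ (~ C i /\ g j = i).
  have [Ci|nCi] := pselect (C i); first by exists (f i); left.
  have [[j ji]|nji] := pselect (exists j, g j = i); first by exists j; right.
  by case: nCi; exists 0%N, i; split=> // j ji; apply: nji; exists j.
have Cgf i : C i -> C (g (f i)).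
  by move=> [n [i0 [ni0 <-]]]; exists n.+1, i0.
have /choice[k kP] j : exists i, h i = j.
  have [[n [i0 [ni0 iE]]]|nC] := pselect (C (g j)); last first.
    exists (g j); have [[]//|[_ /gI//]] := hP (g j).
  case: n iE => [|n] /= iE; first by case: (ni0 j).
  exists (iter n (g \o f) i0); rewrite -(gI _ _ iE).
  have [[_ //]|[nC _]] := hP (iter n (g \o f) i0).
  by case: nC; exists n, i0.
exists h, k; split=> // i.
- have hI x y : h x = h y -> x = y.
    move=> hxy; have [[Cx hx]|[nCx hx]] := hP x;
      have [[Cy hy]|[nCy hy]] := hP y.
    + by apply: fI; rewrite -hx -hy.
    + by case: nCy; rewrite -hy -hxy hx; apply: Cgf.
    + by case: nCx; rewrite -hx hxy hy; apply: Cgf.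
    + by rewrite -hx -hy hxy.
  exact: hI (kP (h i)).
- by have [[_ ->//]|[_ gh]] := hP i; rewrite -{1}gh.
Qed.

(** * Assembling the isomorphism coordinatewise *)

Theorem theorem2p3 (G : zmodType) (hG : torsion_free G)
    (A H A' H' : set G)
    (hdec : direct_sum2 [set: G] A H)
    (hA : completely_decomposable A) (hH : clipped H)
    (hdec' : direct_sum2 [set: G] A' H')
    (hA' : completely_decomposable A') (hH' : clipped H') :
  isomorphic A A'.
Proof.
have [I [B [p [q [D ->]]]]] := direct_sum2_decomposition hG hdec hA.
have [J [B' [p' [q' [D' ->]]]]] := direct_sum2_decomposition hG hdec' hA'.
have [f fI fB] := homogeneous_injection hG D D' hH'.
have [g gI gB] := homogeneous_injection hG D' D hH.
have [h [k [hk kh hB]]] := schroeder_bernstein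
  (E := fun i j => summand_iso (B i) (B' j)) fI gI fB
  (fun j => summand_iso_sym (gB j)).
have /choice[u /choice[v uv]] := hB.
have uB i x : B i x -> B' (h i) (u i x) by case: (uv i) => + _ => /[apply]-[].
have uK i x : B i x -> v i (u i x) = x by case: (uv i) => + _ => /[apply]-[].
have vB i x : B' (h i) x -> B i (v i x) by case: (uv i) => _ /[apply]-[].
have vK i x : B' (h i) x -> u i (v i x) = x by case: (uv i) => _ /[apply]-[].
(* [F] moves the coordinate at [i] to [h i] through [u i] and discards [q x]; it is therefore
   injective only on the kernel of [q], which is the first summand. *)
have /choice[F FE] x : exists y, q' y = 0 /\ forall i, p' (h i) y = u i (p i x).
  have [s [us sx _]] := dec_sum D x.
  have [||j|y [qy py]] := dec_assemble (s := map h s)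
    (b := fun j => u (k j) (p (k j) x)) D'.
  - by rewrite map_inj_uniq //; apply: can_inj hk.
  - by move=> j; rewrite -{1}(kh j); apply: uB; apply: dec_proj_in D _ _.
  - move=> pj; rewrite -(kh j) map_f // sx //.
    by apply: contraNneq pj => ->; rewrite raddf0.
  by exists y; split=> // i; rewrite py hk.
have F_ext x y : q' y = 0 -> (forall i, p' (h i) y = u i (p i x)) -> F x = y.
  move=> qy py; have [qF pF] := FE x; apply: (dec_ext D'); first by rewrite qF.
  by move=> j; rewrite -(kh j) pF py.
exists F; split.
  move=> x y _ _; have [qx px] := FE x; have [qy py] := FE y.
  apply: F_ext; first by rewrite raddfD qx qy addr0.
  by move=> i; rewrite !raddfD px py.
split.
- by move=> x _; have [] := FE x.
- move=> x y /set_mem/= qx /set_mem/= qy Fxy.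
  apply: (dec_ext D); first by rewrite qx.
  move=> i; rewrite -(uK _ _ (dec_proj_in D i x)) -(uK _ _ (dec_proj_in D i y)).
  by rewrite -(FE x).2 -(FE y).2 Fxy.
(* The preimage of [y] has coordinates pulled back through the [v i]; its support is the image under
   [k] of that of [y]. *)
- move=> y /= qy; have [s [us sy _]] := dec_sum D' y.
  have [||i|x [qx px]] := dec_assemble (s := map k s)
    (b := fun i => v i (p' (h i) y)) D.
  + by rewrite map_inj_uniq //; apply: can_inj kh.
  + by move=> i; apply: vB; apply: dec_proj_in D' _ _.
  + move=> pi; rewrite -(hk i) map_f // sy //.
    by apply: contraNneq pi => ->; rewrite raddf0.
  exists x => //; apply: F_ext => // i.
  by rewrite px vK //; apply: dec_proj_in D' _ _.
Qed.
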